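(* Let $p \geq 2$ and let $\mathbf{A}$ be a spectrally unitary $\mathbb{Z}^p$-action on $\mathbb{Z}^3$ satisfying $\mathrm{Fix}(\mathbf{A}) = \{0\}$. Then there exist a basis $\{w_1, \dots, w_p\}$ of $\mathbb{Z}^p$ and an automorphism $h$ of $\mathbb{Z}^3$ such that, for the conjugated action $\ell \mapsto h \circ \mathbf{A}(\ell) \circ h^{-1}$, written as matrices $A(\ell)$ in the canonical basis of $\mathbb{Z}^3$, $$A(w_1) = \begin{bmatrix} 1 & a & b \\ 0 & -1 & 0 \\ 0 & 0 & -1 \end{bmatrix}, \quad A(w_2) = \begin{bmatrix} -1 & 0 & c \\ 0 & -1 & d \\ 0 & 0 & 1 \end{bmatrix}$$ for some integers $a,b,c,d$ with $ad + 2(b+c) = 0$, and $A(\ell)$ is the identity matrix for every $\ell = \sum_{i=1}^p \ell_i w_i \in \mathbb{Z}^p$ with $\ell_1 = \ell_2 = 0$. In particular, the image of $\mathbf{A}$ is isomorphic to the Klein four-group.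
   Context: A $\mathbb{Z}^p$-action $\mathbf{A}$ on $\mathbb{Z}^q$ is spectrally unitary if it is a homomorphism from $\mathbb{Z}^p$ to the group of automorphisms of $\mathbb{Z}^q$ (equivalently $\mathrm{GL}(q,\mathbb{Z})$) and $1$ is an eigenvalue of $\mathbf{A}(\ell)$ for every $\ell \in \mathbb{Z}^p$. $\mathrm{Fix}(\mathbf{A}) = \{k \in \mathbb{Z}^q : \mathbf{A}(\ell)k = k \text{ for all } \ell \in \mathbb{Z}^p\}$. The image of $\mathbf{A}$ is the group $\{\mathbf{A}(\ell) : \ell \in \mathbb{Z}^p\}$. *)

(* Defs.v *)
From HB Require Import structures.
From mathcomp Require Import all_boot all_order all_algebra.
Set Implicit Arguments. Unset Strict Implicit. Unset Printing Implicit Defensive.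
Import Order.TTheory GRing.Theory Num.Theory.
Local Open Scope ring_scope.

(* Z^p is 'rV[int]_p, Z^3 is the column space 'cV[int]_3; an endomorphism
   of Z^3 is a matrix in 'M[int]_3 acting on column vectors (canonical basis). *)

Definition is_action (p : nat) (A : 'rV[int]_p -> 'M[int]_3) : Prop :=
  (forall l, A l \in unitmx) /\
  (forall l1 l2, A (l1 + l2) = A l1 *m A l2).

Definition spectrally_unitary (p : nat) (A : 'rV[int]_p -> 'M[int]_3) : Prop :=
  is_action A /\ (forall l, root (char_poly (A l)) 1).

Definition trivial_Fix (p : nat) (A : 'rV[int]_p -> 'M[int]_3) : Prop :=
  forall k : 'cV[int]_3, (forall l, A l *m k = k) -> k = 0.

Definition M1 (a b : int) : 'M[int]_3 :=
  \matrix_(i < 3, j < 3)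
    nth (0:int) (nth [::] [:: [:: 1; a; b]; [:: 0; -1; 0]; [:: 0; 0; -1]] i) j.

Definition M2 (c d : int) : 'M[int]_3 :=
  \matrix_(i < 3, j < 3)
    nth (0:int) (nth [::] [:: [:: -1; 0; c]; [:: 0; -1; d]; [:: 0; 0; 1]] i) j.

Definition image_iso_Klein (p : nat) (A : 'rV[int]_p -> 'M[int]_3) : Prop :=
  exists phi : bool * bool -> 'M[int]_3,
    injective phi /\
    (forall x y, phi (x.1 (+) y.1, x.2 (+) y.2) = phi x *m phi y) /\
    (forall l, exists x, A l = phi x) /\
    (forall x, exists l, A l = phi x).

(* Main.v *)
Require Import Defs.
From HB Require Import structures.
From mathcomp Require Import all_boot all_order all_algebra all_field.
From mathcomp Require Import zify.
Import Order.TTheory GRing.Theory Num.Theory.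
Local Open Scope ring_scope.

(* Over the algebraic numbers the commuting matrices A(l) are simultaneously
   triangular; their diagonals are three characters of Z^p whose kernels cover
   Z^p.  A trivial character would produce a common fixed vector: for each
   generator B, write char_poly B = q * ('X - 1)^m with q(1) != 0; the product
   of the q(B) is nonzero, and all B - 1 are nilpotent on its image.  So the
   kernels are proper, which forces the characters to be the three nontrivial
   characters of a Klein quotient, and commutation with elements of distinct
   diagonal entries shows that A factors through it.  The basis of Z^p and the
   basis of Z^3 both come from Hermite normal forms, of the matrix of exponents
   of the generators and of the matrix of joint eigenvectors respectively. *)

(** * Integer lattices: induction on vectors and row reduction *)

Lemma int_row_ind (p : nat) (P : 'rV[int]_p -> Prop) :
  P 0 -> (forall u v, P u -> P v -> P (u + v)) ->
  (forall i, P 'e_i) -> (forall i, P (- 'e_i)) -> forall u, P u.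
Proof.
move=> P0 PD Pe PN u; rewrite (row_sum_delta u); apply: (big_ind P) => // i _.
have Pn v n : P v -> P (v *+ n).
  by move=> Pv; elim: n => [|n IH]; rewrite ?mulr0n // mulrS; apply: PD.
rewrite -[u 0 i]intz scaler_int; case: (u 0 i) => n; rewrite ?NegzE ?mulrNz.
  exact: Pn.
by rewrite -mulNrn; apply: Pn.
Qed.

(** The Smith form of the first column supplies a unimodular row operation that clears it below its
    top entry; induction treats the remaining block. Only the zeros below the diagonal are recorded,
    without any normalization of pivots. *)
Lemma int_hermite (m n : nat) (M : 'M[int]_(m, n)) :
  exists2 U : 'M[int]_m, U \in unitmx
    & forall (i : 'I_m) (j : 'I_n), (j < i)%N -> (U *m M) i j = 0.
Proof.
elim: m n M => [|m IH] [|n] M; try by exists 1%:M; rewrite ?unitmx1 // => -[? ?] [].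
rewrite -[n.+1]/(1 + n)%N -[m.+1]/(1 + m)%N in M *.
have [L uL [R _ [d _ eM]]] := int_Smith_normal_form (lsubmx M).
pose N := invmx L *m M.
have N0 : dlsubmx N = 0.
  have e : lsubmx N = invmx L *m lsubmx M.
    by rewrite /N -{1}[M]hsubmxK mul_mx_row row_mxKl.
  apply/matrixP => i j; rewrite (ord1 j) [RHS]mxE.
  transitivity (lsubmx N (rshift 1 i) 0); first by rewrite !mxE.
  rewrite e eM -mulmxA mulKmx // mxE big1 // => k _.
  by rewrite !mxE (ord1 k) mulr0n mul0r.
have [U uU HU] := IH _ (drsubmx N).
exists (block_mx 1%:M 0 0 U *m invmx L).
  by rewrite unitmx_mul unitmx_inv uL andbT unitmxE det_ublock det1 mul1r.
move=> i j ltji; rewrite -mulmxA -/N -[N]submxK N0 mulmx_block.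
rewrite !mul1mx !mul0mx !mulmx0 !addr0 !add0r.
rewrite -(splitK i) in ltji *; case: (split i) ltji => i' /=.
  by rewrite (ord1 i').
rewrite -(splitK j); case: (split j) => j' /= ltji.
  by rewrite block_mxEdl mxE.
by rewrite block_mxEdr; apply: HU; move: ltji; rewrite ltn_add2l.
Qed.

(** * Commuting nilpotents and fixed vectors *)

(** Multiply [w] in turn by the highest power of each element that keeps the result nonzero;
    commutation preserves what is already annihilated. *)
Lemma common_annihilator (R : nzRingType) (Bs : seq R) (w : R) :
  {in Bs &, forall B C, GRing.comm B C} -> w != 0 ->
  {in Bs, forall B, exists k, B ^+ k * w = 0} ->
  exists2 v, v != 0 & {in Bs, forall B, B * v = 0}.
Proof.
move=> cBs w0 nil.
(* The last conjunct strengthens the induction: it makes the multiplier [C] found for the tail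
   commute with the new head. *)
suff [C [Cw0 HC _]] : exists C, [/\ C * w != 0,
    {in Bs, forall B, B * (C * w) = 0}
  & forall D, {in Bs, forall B, GRing.comm D B} -> GRing.comm D C].
  by exists (C * w).
elim: Bs cBs nil => [|B Bs IH] cBs nil.
  by exists 1; split=> //; [rewrite mul1r | move=> D _; apply: commr1].
have sub D : D \in Bs -> D \in B :: Bs by rewrite inE orbC => ->.
have [||C [Cw HC cC]] := IH.
- by move=> D D' /sub hD /sub hD'; apply: cBs.
- by move=> D /sub; apply: nil.
have cBC : GRing.comm B C.
  by apply: cC => D /sub hD; apply: cBs => //; rewrite mem_head.
have ex : exists k, B ^+ k * (C * w) == 0.
  have [k Bk] := nil B (mem_head _ _); exists k.
  by rewrite mulrA -(commrX _ (commr_sym cBC)) -mulrA Bk mulr0.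
case: (ex_minnP ex) => [[|k]]; first by rewrite mul1r (negPf Cw).
move=> /eqP Bk mink.
exists (B ^+ k * C); split.
- rewrite -mulrA; apply/negP => /mink; by rewrite ltnn.
- move=> D; rewrite inE => /predU1P[->|hD]; first by rewrite -mulrA mulrA -exprS.
  have cDB : GRing.comm D B by apply: cBs; rewrite ?mem_head ?sub.
  by rewrite -mulrA mulrA (commrX _ cDB) -mulrA HC ?mulr0.
- move=> D cD; apply: commrM; first by apply/commrX/cD/mem_head.
  by apply: cC => D' /sub; apply: cD.
Qed.

Lemma char_poly_root1 (n : nat) (B : 'M[int]_n) :
  root (char_poly B) 1 -> exists2 v : 'cV[int]_n, v != 0 & B *m v = v.
Proof.
rewrite /root /char_poly -horner_evalE -det_map_mx.
(* [det0P] yields a row vector in the kernel; the double transpose turns it into a column fixed by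
   [B]. *)
have -> : map_mx (horner_eval 1) (char_poly_mx B) = (1%:M - B^T)^T.
  by apply/matrixP => i j; rewrite !mxE /horner_eval !hornerE hornerMn hornerX eq_sym.
rewrite det_tr => /det0P[v v0]; rewrite mulmxBr mulmx1 => /eqP.
rewrite subr_eq0 => /eqP e; exists v^T.
  by apply: contraNneq v0 => e'; rewrite -[v]trmxK e' trmx0.
by rewrite {2}e trmx_mul trmxK.
Qed.

(** * Normal form of two commuting integer involutions *)

Lemma mulmx3E (R : pzSemiRingType) (m n : nat) (B : 'M[R]_(m, 3)) (C : 'M[R]_(3, n)) i j :
  (B *m C) i j = B i 0 * C 0 j + B i 1 * C 1 j + B i 2 * C 2 j.
Proof.
rewrite mxE !big_ord_recr big_ord0 /= add0r.
by congr (_ * _ + _ * _ + _ * _); congr (fun_of_matrix _ _ _); apply/val_inj.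
Qed.

Lemma ord3P (P : 'I_3 -> Prop) : P 0 -> P 1 -> P 2 -> forall i, P i.
Proof.
move=> P0 P1 P2 [[|[|[|//]]] hi].
- by rewrite (_ : Ordinal hi = 0) //; apply/val_inj.
- by rewrite (_ : Ordinal hi = 1) //; apply/val_inj.
- by rewrite (_ : Ordinal hi = 2) //; apply/val_inj.
Qed.

(** The eigenvectors are in echelon form, so the columns of [X] and [Y] are read off one after the
    other by cancelling the pivots [t1 0 0], [t2 1 0], [t3 2 0]. *)
Lemma triangular_eigenvectors_M1_M2 (X Y : 'M[int]_3) (t1 t2 t3 : 'cV[int]_3) :
  X *m Y = Y *m X -> t1 != 0 -> t2 != 0 -> t3 != 0 ->
  t1 1 0 = 0 -> t1 2 0 = 0 -> t2 2 0 = 0 ->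
  X *m t1 = 1 *: t1 -> X *m t2 = -1 *: t2 -> X *m t3 = -1 *: t3 ->
  Y *m t1 = -1 *: t1 -> Y *m t2 = -1 *: t2 -> Y *m t3 = 1 *: t3 ->
  [/\ X = M1 (X 0 1) (X 0 2), Y = M2 (Y 0 2) (Y 1 2)
    & X 0 1 * Y 1 2 + 2 * (X 0 2 + Y 0 2) = 0].
Proof.
move=> XY t10 t20 t30 t11 t12 t22.
have E (Z : 'M[int]_3) (e : int) (t : 'cV[int]_3) : Z *m t = e *: t ->
    forall i, Z i 0 * t 0 0 + Z i 1 * t 1 0 + Z i 2 * t 2 0 = e * t i 0.
  by move=> eZ i; rewrite -mulmx3E eZ mxE.
have col0 (t : 'cV[int]_3) : t 0 0 = 0 -> t 1 0 = 0 -> t 2 0 = 0 -> t = 0.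
  by move=> *; apply/matrixP => i j; rewrite (ord1 j) mxE; elim/ord3P: i.
move=> /E X1 /E X2 /E X3 /E Y1 /E Y2 /E Y3.
have p0 : t1 0 0 != 0 by apply: contraNneq t10 => e; apply/eqP/col0.
have cancel (r x y : int) : r != 0 -> x * r = y * r -> x = y by move=> r0 /(mulIf r0).
have X00 : X 0 0 = 1 by apply: cancel p0 _; have := X1 0; rewrite t11 t12; lia.
have X10 : X 1 0 = 0 by apply: cancel p0 _; have := X1 1; rewrite t11 t12; lia.
have X20 : X 2 0 = 0 by apply: cancel p0 _; have := X1 2; rewrite t11 t12; lia.
have Y00 : Y 0 0 = -1.
  by apply: cancel p0 _; have := Y1 0; rewrite t11 t12; lia.
have Y10 : Y 1 0 = 0.
  by apply: cancel p0 _; have := Y1 1; rewrite t11 t12; lia.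
have Y20 : Y 2 0 = 0.
  by apply: cancel p0 _; have := Y1 2; rewrite t11 t12; lia.
(* Otherwise [t2] is a multiple of the first canonical vector, on which [X] acts as $1$ instead of
   $-1$. *)
have q0 : t2 1 0 != 0.
  apply: contraNneq t20 => e; apply/eqP/col0 => //.
  by have := X2 0; rewrite X00 e t22; lia.
have X11 : X 1 1 = -1.
  by apply: cancel q0 _; have := X2 1; rewrite X10 t22; lia.
have X21 : X 2 1 = 0.
  by apply: cancel q0 _; have := X2 2; rewrite X20 t22; lia.
have Y01 : Y 0 1 = 0.
  by apply: cancel q0 _; have := Y2 0; rewrite Y00 t22; lia.
have Y11 : Y 1 1 = -1.
  by apply: cancel q0 _; have := Y2 1; rewrite Y10 t22; lia.
have Y21 : Y 2 1 = 0.
  by apply: cancel q0 _; have := Y2 2; rewrite Y20 t22; lia.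
(* Otherwise [t3] lies in the plane of the first two coordinates, where [Y] acts as $-1$ instead of
   $1$. *)
have r0 : t3 2 0 != 0.
  apply: contraNneq t30 => e; apply/eqP/col0 => //.
    by have := Y3 0; rewrite Y00 Y01 e; lia.
  by have := Y3 1; rewrite Y10 Y11 e; lia.
have X12 : X 1 2 = 0.
  by apply: cancel r0 _; have := X3 1; rewrite X10 X11; lia.
have X22 : X 2 2 = -1.
  by apply: cancel r0 _; have := X3 2; rewrite X20 X21; lia.
have Y22 : Y 2 2 = 1.
  by apply: cancel r0 _; have := Y3 2; rewrite Y20 Y21; lia.
split.
- by apply/matrixP => i j; rewrite [RHS]mxE; elim/ord3P: i; elim/ord3P: j.
- by apply/matrixP => i j; rewrite [RHS]mxE; elim/ord3P: i; elim/ord3P: j.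
(* The relation between the four integers is the entry $(0,2)$ of $XY = YX$. *)
- have : X 0 0 * Y 0 2 + X 0 1 * Y 1 2 + X 0 2 * Y 2 2
         = Y 0 0 * X 0 2 + Y 0 1 * X 1 2 + Y 0 2 * X 2 2.
    by rewrite -!mulmx3E XY.
  by rewrite X00 X12 X22 Y00 Y01 Y22; lia.
Qed.

(** A difference such as $u - Yu$ is a joint eigenvector, nonzero because no nonzero vector is fixed
    by both involutions. Fixed vectors of $X$, $XY$ and $Y$ yield in this way the sign pairs
    $(1,-1)$, $(-1,-1)$ and $(-1,1)$. *)
Lemma involutions_normal_form (X Y : 'M[int]_3) :
  X *m X = 1%:M -> Y *m Y = 1%:M -> X *m Y = Y *m X ->
  (forall k : 'cV[int]_3, X *m k = k -> Y *m k = k -> k = 0) ->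
  (exists2 u : 'cV[int]_3, u != 0 & X *m u = u) ->
  (exists2 u : 'cV[int]_3, u != 0 & Y *m u = u) ->
  (exists2 u : 'cV[int]_3, u != 0 & X *m Y *m u = u) ->
  exists (h : 'M[int]_3) (a b c d : int),
    [/\ h \in unitmx, a * d + 2 * (b + c) = 0,
        h *m X *m invmx h = M1 a b & h *m Y *m invmx h = M2 c d].
Proof.
move=> XX YY XY fix0 [u u0 Xu] [w w0 Yw] [v v0 XYv].
have [f1 [f10 Xf1 Yf1]] : exists f : 'cV[int]_3, [/\ f != 0, X *m f = f & Y *m f = - f].
  exists (u - Y *m u); rewrite !mulmxBr !mulmxA YY XY -mulmxA Xu mul1mx opprB.
  split=> //; apply: contraNneq u0 => /eqP; rewrite subr_eq0 => /eqP e.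
  by apply/eqP/fix0.
have [f2 [f20 Xf2 Yf2]] : exists f : 'cV[int]_3, [/\ f != 0, X *m f = - f & Y *m f = - f].
  have Yv : Y *m v = X *m v by rewrite -{2}XYv !mulmxA XX mul1mx.
  exists (v - X *m v); rewrite !mulmxBr !mulmxA XX -XY XYv Yv mul1mx opprB.
  split=> //; apply: contraNneq v0 => /eqP; rewrite subr_eq0 => /eqP e.
  by apply/eqP/fix0; rewrite ?Yv.
have [f3 [f30 Xf3 Yf3]] : exists f : 'cV[int]_3, [/\ f != 0, X *m f = - f & Y *m f = f].
  exists (w - X *m w); rewrite !mulmxBr !mulmxA XX -XY -mulmxA Yw mul1mx opprB.
  split=> //; apply: contraNneq w0 => /eqP; rewrite subr_eq0 => /eqP e.
  by apply/eqP/fix0.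
(* The three eigenvectors need not generate $\mathbb{Z}^3$, so row reduction replaces them by a
   basis adapted to their flag. Their order matches the diagonals of [M1] and [M2]. *)
have [U uU HU] := int_hermite _ _ (row_mx f1 (row_mx f2 f3) : 'M_(3, 1 + (1 + 1))).
pose C (Z : 'M[int]_3) := U *m Z *m invmx U.
have CM Z f : C Z *m (U *m f) = U *m (Z *m f) :> 'cV_3.
  by rewrite /C !mulmxA mulmxKV.
have U0 f : f != 0 -> U *m f != 0 :> 'cV_3.
  by apply: contraNneq => e; rewrite -[f](mulKmx uU) e mulmx0.
have T0 (i : 'I_3) : (0 < i)%N -> (U *m f1) i 0 = 0.
  move=> hi; rewrite -(HU i (lshift _ 0)) // [in RHS]mul_mx_row row_mxEl //.
have T1 (i : 'I_3) : (1 < i)%N -> (U *m f2) i 0 = 0.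
  move=> hi; rewrite -(HU i (rshift 1 (lshift 1 0))) // [in RHS]mul_mx_row row_mxEr.
  by rewrite mul_mx_row row_mxEl.
have C1 Z f : Z *m f = f -> C Z *m (U *m f) = 1 *: (U *m f) :> 'cV_3.
  by move=> e; rewrite CM e scale1r.
have CN1 Z f : Z *m f = - f -> C Z *m (U *m f) = -1 *: (U *m f) :> 'cV_3.
  by move=> e; rewrite CM e mulmxN scaleN1r.
have CXY : C X *m C Y = C Y *m C X.
  by rewrite /C !mulmxA !(mulmxKV uU) -!(mulmxA U) XY.
have [eX eY abcd] := triangular_eigenvectors_M1_M2 _ _ _ _ _ CXY
  (U0 _ f10) (U0 _ f20) (U0 _ f30) (T0 1 isT) (T0 2 isT) (T1 2 isT)
  (C1 _ _ Xf1) (CN1 _ _ Xf2) (CN1 _ _ Xf3) (CN1 _ _ Yf1) (CN1 _ _ Yf2) (C1 _ _ Yf3).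
by exists U, (C X 0 1), (C X 0 2), (C Y 0 2), (C Y 1 2); split.
Qed.

(** * Actions of $\mathbb{Z}^p$ and their joint triangular form *)

Lemma map_intr_mx_inj (R : numDomainType) (m n : nat) :
  injective (map_mx intr : 'M[int]_(m, n) -> 'M[R]_(m, n)).
Proof.
move=> B C /matrixP e; apply/matrixP => i j.
by have := e i j; rewrite !mxE => /intr_inj.
Qed.

Lemma action0 (p : nat) (A : 'rV[int]_p -> 'M[int]_3) : is_action A -> A 0 = 1%:M.
Proof.
move=> [uA AD]; have := AD 0 0; rewrite addr0 => e.
by rewrite -[LHS](mulKmx (uA 0)) -e mulVmx.
Qed.

Lemma actionN (p : nat) (A : 'rV[int]_p -> 'M[int]_3) l :
  is_action A -> A (- l) = invmx (A l).
Proof.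
move=> actA; have [uA AD] := actA.
by rewrite -[LHS](mulKmx (uA l)) -AD subrr action0 // mulmx1.
Qed.

Lemma action_fixed (p : nat) (A : 'rV[int]_p -> 'M[int]_3) (W : 'M[int]_p)
    (k : 'cV[int]_3) :
  is_action A -> W \in unitmx -> (forall i, A (row i W) *m k = k) ->
  forall l, A l *m k = k.
Proof.
move=> actA uW Wk l; have [uA AD] := actA.
rewrite -(mulmxKV uW l); elim/int_row_ind: (l *m invmx W) => [|u v Au Av|i|i].
- by rewrite mul0mx action0 // mul1mx.
- by rewrite mulmxDl AD -mulmxA Av.
- by rewrite -rowE.
- by rewrite mulNmx -rowE actionN // -{1}(Wk i) mulKmx.
Qed.

(** Here [is_trig_mx] means lower triangular. The diagonal part is what turns each diagonal position
    of a triangularized action into a multiplicative character. *)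
Lemma trig_mulmx (R : pzSemiRingType) (n : nat) (S T : 'M[R]_n) :
  is_trig_mx S -> is_trig_mx T ->
  is_trig_mx (S *m T) /\ forall i, (S *m T) i i = S i i * T i i.
Proof.
move=> /is_trig_mxP S0 /is_trig_mxP T0; split=> [|i]; last first.
  rewrite mxE (bigD1 i) //= big1 ?addr0 // => j; rewrite neq_ltn => /orP[h|h].
    by rewrite T0 ?mulr0.
  by rewrite S0 ?mul0r.
apply/is_trig_mxP => i j ij; rewrite mxE big1 // => k _.
have [ik|ki] := ltnP i k; first by rewrite S0 ?mul0r.
by rewrite T0 ?mulr0 // (leq_ltn_trans ki).
Qed.

Lemma trig_horner_mx (R : comNzRingType) (n : nat) (T : 'M[R]_n.+1) (q : {poly R}) :
  is_trig_mx T ->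
  is_trig_mx (horner_mx T q) /\ forall i, horner_mx T q i i = q.[T i i].
Proof.
move=> tT; elim/poly_ind: q => [|q c [tq dq]].
  by rewrite rmorph0; split=> [|i]; rewrite ?mx0_is_trig // mxE horner0.
have [tqT dqT] := trig_mulmx _ _ _ _ tq tT.
rewrite rmorphD rmorphM /= horner_mx_X horner_mx_C; split=> [|i].
  apply/is_trig_mxP => i j ij; rewrite mxE.
  by rewrite !(is_trig_mxP _) ?addr0 ?scalar_mx_is_trig.
by rewrite mxE dqT dq mxE eqxx mulr1n !hornerE.
Qed.

Lemma joint_triangularization (p : nat) (A : 'rV[int]_p -> 'M[int]_3) :
  is_action A -> exists2 P : 'M[algC]_3, P \in unitmx
    & forall l, is_trig_mx (P *m map_mx intr (A l) *m invmx P).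
Proof.
move=> actA; have [uA AD] := actA.
pose AC l : 'M[algC]_3 := map_mx intr (A l).
(* Cotrigonalization takes a finite family. Including the opposites of the generators lets
   triangularity spread by sums alone, without inverting triangular matrices. *)
pose gens : seq 'rV[int]_p :=
  [seq 'e_i | i <- enum 'I_p] ++ [seq - 'e_i | i <- enum 'I_p].
have [P /unitarymx_unit uP /allP/= trP] : exists2 P : 'M[algC]_3, P \is unitarymx
    & all [pred B | similar_trig P B] [seq AC l | l <- gens].
  apply: cotrigonalization => _ _ /mapP[l _ ->] /mapP[l' _ ->].
  by rewrite /comm_mx /AC -!map_mxM -!AD addrC.
exists P => //; elim/int_row_ind => [|u v tu tv|i|i].
- by rewrite action0 // map_mx1 mulmx1 mulmxV // scalar_mx_is_trig.
- have [+ _] := trig_mulmx _ _ _ _ tu tv.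
  by rewrite AD map_mxM !mulmxA mulmxKV.
- rewrite -conjumx //; apply/trP/map_f; rewrite mem_cat.
  by apply/orP; left; apply/map_f; rewrite mem_enum.
- rewrite -conjumx //; apply/trP/map_f; rewrite mem_cat.
  by apply/orP; right; apply/map_f; rewrite mem_enum.
Qed.

(** The factor $(X-1)^m$ is split off the characteristic polynomials over $\mathbb{Z}$, so the fixed
    vector is integral; the complex triangular form serves only to show that a product of matrices
    is nonzero. *)
Lemma trivial_character_fixed_vector (p : nat) (A : 'rV[int]_p -> 'M[int]_3)
    (P : 'M[algC]_3) (i : 'I_3) :
  is_action A -> P \in unitmx ->
  (forall l, is_trig_mx (P *m map_mx intr (A l) *m invmx P)) ->
  (forall l, (P *m map_mx intr (A l) *m invmx P) i i = 1) ->
  exists2 k : 'cV[int]_3, k != 0 & forall l, A l *m k = k.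
Proof.
move=> actA uP tA dA; have [uA AD] := actA.
pose f (B : 'M[int]_3) : 'M[algC]_3 := P *m map_mx intr B *m invmx P.
have fM B C : f (B *m C) = f B *m f C.
  by rewrite /f map_mxM !mulmxA mulmxKV.
have fh B q : f (horner_mx B q) = horner_mx (f B) (map_poly intr q).
  by rewrite /f map_horner_mx horner_mx_uconj.
have cA j l : GRing.comm (A j) (A l) by rewrite /GRing.comm -!mulmxE -!AD addrC.
have cAh j l q : GRing.comm (A j) (horner_mx (A l) q).
  exact/comm_mx_horner/cA.
pose s := enum 'I_p.
(* [w] is the product of the matrices $q_j(A(e_j))$; its conjugate has $\prod_j q_j(1) \neq 0$ as
   diagonal entry [i], because the character there is trivial. *)
have [w [tw dw nw _]] : exists w : 'M[int]_3, [/\ is_trig_mx (f w), f w i i != 0,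
    {in s, forall j, exists k, (A 'e_j - 1) ^+ k * w = 0} &
    forall l, GRing.comm (A l) w].
  elim: s => [|j s [w [tw dw nw cw]]].
    exists 1%:M; rewrite /f map_mx1 mulmx1 mulmxV //; split=> // [|l].
    - by rewrite mxE eqxx oner_eq0.
    - exact: commr1.
  have [m [q qr eq]] := multiplicity_XsubC (char_poly (A 'e_j)) 1.
  have q1 : q.[1] != 0.
    by move: qr; rewrite (monic_neq0 (char_poly_monic _)).
  have [th dh] := trig_horner_mx _ _ _ (map_poly intr q) (tA 'e_j).
  have [th' dh'] := trig_mulmx _ _ _ _ th tw.
  exists (horner_mx (A 'e_j) q *m w); rewrite fM fh; split=> // [|j'|l].
  - rewrite dh' dh dA mulf_neq0 //.
    by rewrite -[1](rmorph1 (intr : int -> algC)) horner_map intr_eq0.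
  - rewrite inE => /predU1P[->|/nw[k ek]].
      exists m; rewrite -mulmxE mulmxA mulmxE.
      suff -> : (A 'e_j - 1) ^+ m * horner_mx (A 'e_j) q = 0 by rewrite mul0r.
      rewrite -(Cayley_Hamilton (A 'e_j)) eq [q * _]mulrC rmorphM rmorphXn /=.
      by rewrite rmorphB /= horner_mx_X horner_mx_C.
    exists k; rewrite -mulmxE mulmxA mulmxE.
    have /(commrX k) c : GRing.comm (horner_mx (A 'e_j) q) (A 'e_j' - 1).
      apply: commrB; last exact: commr1.
      exact/commr_sym/cAh.
    by rewrite -c -mulrA ek mulr0.
  - by rewrite mulmxE; apply: commrM.
have w0 : w != 0.
  by apply: contraNneq dw => ->; rewrite /f map_mx0 mulmx0 mul0mx mxE.
(* Applied in the matrix ring itself: [v] is a matrix, and any nonzero column of it is the required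
   vector. *)
have [||v v0 Av] := common_annihilator _ [seq A 'e_j - 1 | j <- s] w _ w0.
- move=> _ _ /mapP[j _ ->] /mapP[j' _ ->].
  by apply: commrB; [apply: commr_sym; apply: commrB|]; rewrite ?commr1 //;
     apply: commr1.
- by move=> _ /mapP[j /nw ? ->].
have [c vc] : exists c, col c v != 0.
  apply/existsP; apply: contraNT v0 => /existsPn v0.
  apply/eqP/matrixP => a b; have /negPn/eqP/matrixP/(_ a 0) := v0 b.
  by rewrite !mxE.
exists (col c v) => //; apply: (action_fixed _ _ _ _ actA (unitmx1 _ _)) => j.
rewrite row1 colE mulmxA; congr (_ *m _).
have := Av _ (map_f _ (mem_enum _ j)); rewrite mulrBl mul1r => /eqP.
by rewrite subr_eq0 => /eqP.
Qed.

(** * Multiplicative characters whose kernels cover a group *)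

(** A group is not the union of two proper subgroups. *)
Lemma two_kernels_proper (V : zmodType) (F : fieldType) (f g : V -> F) :
  {morph f : u v / u + v >-> u * v} -> {morph g : u v / u + v >-> u * v} ->
  (exists u, f u != 1) -> (exists u, g u != 1) -> exists u, f u != 1 /\ g u != 1.
Proof.
move=> fD gD [a fa] [b gb].
have [ga|] := eqVneq (g a) 1; last by exists a.
have [fb|] := eqVneq (f b) 1; last by exists b.
by exists (a + b); rewrite fD gD fb ga mulr1 mul1r.
Qed.

(** The element $x+y$ lies outside the kernels of [f] and [g], so $h(x)h(y) = 1$. Then $2x+y$ lies
    outside those of [f] and [h], which forces $g(x)^2 = 1$. *)
Lemma kernel_cover_sign (V : zmodType) (F : fieldType) (f g h : V -> F) x y :
  {morph f : u v / u + v >-> u * v} -> {morph g : u v / u + v >-> u * v} ->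
  {morph h : u v / u + v >-> u * v} ->
  (forall u, [\/ f u = 1, g u = 1 | h u = 1]) ->
  f x = 1 -> g x != 1 -> h x != 1 -> f y != 1 -> g y = 1 -> h y != 1 -> g x = -1.
Proof.
move=> fD gD hD cov fx gx hx fy gy hy.
have hxy : h x * h y = 1.
  case: (cov (x + y)); rewrite ?fD ?gD ?hD ?fx ?gy ?mul1r ?mulr1 // => e.
    by rewrite e eqxx in fy.
  by rewrite e eqxx in gx.
case: (cov (x + (x + y))); rewrite ?fD ?gD ?hD ?fx ?gy ?hxy ?mul1r ?mulr1 => e.
- by rewrite e eqxx in fy.
- by move/eqP: e; rewrite -expr2 sqrf_eq1 (negPf gx) => /eqP.
- by rewrite e eqxx in hx.
Qed.

Lemma three_kernels_Klein (V : zmodType) (F : fieldType) (f g h : V -> F) :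
  {morph f : u v / u + v >-> u * v} -> {morph g : u v / u + v >-> u * v} ->
  {morph h : u v / u + v >-> u * v} -> (2 : F) != 0 ->
  (exists u, f u != 1) -> (exists u, g u != 1) -> (exists u, h u != 1) ->
  (forall u, [\/ f u = 1, g u = 1 | h u = 1]) ->
  let val3 u (b : bool * bool) :=
    [/\ f u = (-1) ^+ b.1, g u = (-1) ^+ b.2 & h u = (-1) ^+ (b.1 (+) b.2)] in
  (forall u, exists b, val3 u b) /\ (forall b, exists u, val3 u b).
Proof.
move=> fD gD hD ch nf ng nh cov val3.
have N1 : (-1 : F) != 1 by rewrite eq_sym -subr_eq0 opprK.
have [x [gx hx]] := two_kernels_proper _ _ _ _ gD hD ng nh.
have fx : f x = 1.
  by case: (cov x) => // e; [rewrite e eqxx in gx | rewrite e eqxx in hx].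
have [y [fy hy]] := two_kernels_proper _ _ _ _ fD hD nf nh.
have gy : g y = 1.
  by case: (cov y) => // e; [rewrite e eqxx in fy | rewrite e eqxx in hy].
have [z [fz gz]] := two_kernels_proper _ _ _ _ fD gD nf ng.
have hz : h z = 1.
  by case: (cov z) => // e; [rewrite e eqxx in fz | rewrite e eqxx in gz].
have cov' u : [\/ f u = 1, h u = 1 | g u = 1].
  by case: (cov u) => e; [constructor 1 | constructor 3 | constructor 2].
have cov'' u : [\/ g u = 1, h u = 1 | f u = 1].
  by case: (cov u) => e; [constructor 3 | constructor 1 | constructor 2].
have cov3 u : [\/ g u = 1, f u = 1 | h u = 1].
  by case: (cov u) => e; [constructor 2 | constructor 1 | constructor 3].
have {}gx : g x = -1 := kernel_cover_sign _ _ f g h x y fD gD hD cov fx gx hx fy gy hy.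
have gx1 : g x != 1 by rewrite gx.
have hx' : h x = -1 := kernel_cover_sign _ _ f h g x z fD hD gD cov' fx hx gx1 fz hz gz.
have hy' : h y = -1 := kernel_cover_sign _ _ g h f y z gD hD fD cov'' gy hy fy gz hz fz.
have fy' : f y = -1 := kernel_cover_sign _ _ g f h y x gD fD hD cov3 gy fy hy gx1 fx hx.
split=> [u|[[] []]].
(* Adding $x$, $y$ or $x+y$ flips the signs of two of the three values. The four covering conditions
   together leave exactly the four sign patterns of product $1$. *)
- have := cov u; have := cov (u + x); have := cov (u + y); have := cov (u + (x + y)).
  rewrite !fD !gD !hD fx gx hx' gy hy' fy' !(mulr1, mul1r, mulrN1, mulrNN, opprK).
  have eN (t : F) : - t = 1 -> t = -1 by move=> <-; rewrite opprK.
  have D (t : F) : t = 1 -> t = -1 -> False.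
    by move=> -> e; rewrite -e eqxx in N1.
  case=> [/eN|/eN|] e1; case=> [/eN||/eN] e2; case=> [|/eN|/eN] e3; case=> e4;
    try by [case: (D _ e4 e1)|case: (D _ e4 e2)|case: (D _ e4 e3)
           |case: (D _ e3 e1)|case: (D _ e3 e2)|case: (D _ e2 e1)
           |case: (D _ e1 e2)|case: (D _ e1 e3)|case: (D _ e2 e3)];
    rewrite /val3; first
    [ by exists (false, false); rewrite /= expr0
    | by exists (false, true); rewrite /= expr0 expr1
    | by exists (true, false); rewrite /= expr0 expr1
    | by exists (true, true); rewrite /= expr0 expr1].
- exists (x + y); split; rewrite ?fD ?gD ?hD ?fx ?gx ?hx' ?fy' ?gy ?hy' /=;
    by rewrite ?expr0 ?expr1 ?mulrNN ?mul1r ?mulr1.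
- by exists y; split; rewrite ?expr1.
- by exists x; split; rewrite ?expr1.
- by exists (x + x); split; rewrite ?fD ?gD ?hD ?fx ?gx ?hx' ?mulrNN ?mulr1.
Qed.

(** * The image as a Klein four-group *)

(** Commutation with [X] kills the two subdiagonal entries of [N]; the corner entry then satisfies
    $N_{20}(Y_{00}-Y_{22}) = 0$. Two matrices are used because a sign diagonal of length three
    cannot have all entries distinct. *)
Lemma commuting_unitriangular_mx1 (F : fieldType) (N X Y : 'M[F]_3) :
  is_trig_mx N -> is_trig_mx X -> is_trig_mx Y ->
  (forall i, N i i = 1) -> N *m X = X *m N -> N *m Y = Y *m N ->
  X 0 0 != X 1 1 -> X 1 1 != X 2 2 -> Y 0 0 != Y 2 2 -> N = 1%:M.
Proof.
move=> /is_trig_mxP N0 /is_trig_mxP X0 /is_trig_mxP Y0 N1 NX NY X01 X12 Y02.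
have cancel (a b t : F) : a != b -> t * a = t * b -> t = 0.
  move=> ab /eqP; rewrite -subr_eq0 -mulrBr mulf_eq0 (subr_eq0 a b) (negPf ab) orbF.
  by move/eqP.
have N10 : N 1 0 = 0.
  apply: cancel X01 _; move/matrixP/(_ 1 0): NX; rewrite !mulmx3E !N1.
  rewrite (N0 1 2) ?(X0 1 2) // !mul0r !addr0 mul1r mulr1 addrC mulrC => /addrI ->.
  by rewrite mulrC.
have N21 : N 2 1 = 0.
  apply: cancel X12 _; move/matrixP/(_ 2 1): NX; rewrite !mulmx3E !N1.
  rewrite (N0 0 1) ?(X0 0 1) // !mulr0 !add0r mul1r mulr1 addrC => /addrI ->.
  by rewrite mulrC.
have N20 : N 2 0 = 0.
  apply: cancel Y02 _; move/matrixP/(_ 2 0): NY; rewrite !mulmx3E !N1 N10 N21.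
  by rewrite mul0r mulr0 !addr0 mul1r mulr1 addrC => /addrI ->; rewrite mulrC.
apply/matrixP => i j; rewrite [RHS]mxE.
by elim/ord3P: i; elim/ord3P: j; rewrite ?N1 ?N10 ?N20 ?N21 ?N0.
Qed.

Lemma image_Klein (p : nat) (A : 'rV[int]_p -> 'M[int]_3) :
  spectrally_unitary A -> trivial_Fix A -> image_iso_Klein A.
Proof.
move=> [actA specA] fixA; have [uA AD] := actA.
have [P uP tA] := joint_triangularization p A actA.
pose T l : 'M[algC]_3 := P *m map_mx intr (A l) *m invmx P.
have TD u v : T (u + v) = T u *m T v.
  by rewrite /T AD map_mxM !mulmxA mulmxKV.
have chiD i : {morph (fun l => T l i i) : u v / u + v >-> u * v}.
  by move=> u v; rewrite TD; have [_] := trig_mulmx _ _ _ _ (tA u) (tA v).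
have T_inj u v : T u = T v -> A u = A v.
  move=> /(congr1 (fun B => invmx P *m (B *m P))).
  by rewrite /T !(mulmxKV uP) !(mulKmx uP) => /map_intr_mx_inj.
have T0 : T 0 = 1%:M by rewrite /T action0 // map_mx1 mulmx1 mulmxV.
have chiN l i : T l i i * T (- l) i i = 1.
  by rewrite -chiD subrr T0 mxE eqxx.
have chi_nt i : exists l, T l i i != 1.
  have [/existsP[j Tj]|/existsPn T1] := boolP [exists j, T 'e_j i i != 1].
    by exists 'e_j.
  have {}T1 j : T 'e_j i i = 1 by apply/eqP/negPn/T1.
  have [|k k0 Ak] := trivial_character_fixed_vector p A P i actA uP tA.
    rewrite -/T; elim/int_row_ind => [|u v eu ev|j|j].
    - by rewrite -/(T 0) T0 mxE eqxx.
    - by rewrite -/(T (u + v)) chiD /= [T u i i]eu [T v i i]ev mulr1.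
    - exact: T1.
    - by have := chiN 'e_j i; rewrite T1 mul1r.
  by rewrite (fixA k Ak) eqxx in k0.
(* A fixed vector of [A l] becomes a fixed vector [w] of the lower triangular [T l]; at the first
   nonzero coordinate of [w] the diagonal entry must be $1$. *)
have chi_cov l : [\/ T l 0 0 = 1, T l 1 1 = 1 | T l 2 2 = 1].
  have [v v0 Av] := char_poly_root1 _ _ (specA l).
  pose w : 'cV[algC]_3 := P *m map_mx intr v.
  have w0 : w != 0.
    apply: contraNneq v0 => /(congr1 (mulmx (invmx P))).
    by rewrite mulKmx // mulmx0 -(map_mx0 (intr : int -> algC)) => /map_intr_mx_inj ->.
  have Tw i : T l i 0 * w 0 0 + T l i 1 * w 1 0 + T l i 2 * w 2 0 = w i 0.
    by rewrite -mulmx3E /T /w mulmxA mulmxKV // -mulmxA -map_mxM Av.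
  have /is_trig_mxP tl := tA l.
  have fix1 (a b : algC) : a * b = b -> a = 1 \/ b = 0.
    have [->|b0] := eqVneq b 0; first by right.
    by rewrite -{2}[b]mul1r => /(mulIf b0); left.
  have := Tw 0; rewrite [T l 0 1]tl // [T l 0 2]tl // !mul0r !addr0.
  case/fix1 => [|w00]; first by constructor 1.
  have := Tw 1; rewrite [T l 1 2]tl // w00 mul0r mulr0 addr0 add0r.
  case/fix1 => [|w10]; first by constructor 2.
  have := Tw 2; rewrite w00 w10 !mulr0 !add0r.
  case/fix1 => [|w20]; first by constructor 3.
  case/eqP: w0; apply/matrixP => i j; rewrite (ord1 j) [RHS]mxE.
  by elim/ord3P: i.
have two0 : (2 : algC) != 0 by rewrite pnatr_eq0.
have [chi_sg sg_chi] := three_kernels_Klein _ _ _ _ _ (chiD 0) (chiD 1) (chiD 2)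
  two0 (chi_nt 0) (chi_nt 1) (chi_nt 2) chi_cov.
(* [T (u - v)] is unitriangular and commutes with elements of diagonals $(-1,1,-1)$ and $(1,-1,-1)$,
   hence is the identity. *)
have chi_inj u v : (forall i, T u i i = T v i i) -> A u = A v.
  move=> e; apply: T_inj; rewrite -[u](subrK v) TD.
  have [x [x0 x1 x2]] := sg_chi (true, false).
  have [y [y0 y1 y2]] := sg_chi (false, true).
  have N1 : (-1 : algC) != 1 by rewrite eq_sym -subr_eq0 opprK.
  rewrite (commuting_unitriangular_mx1 _ (T (u - v)) (T x) (T y)
    (tA _) (tA _) (tA _)) ?mul1mx //.
  - by move=> i; rewrite chiD /= e chiN.
  - by rewrite -!TD addrC.
  - by rewrite -!TD addrC.
  - by rewrite x0 x1 /= expr0.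
  - by rewrite x1 x2 /= expr0 eq_sym.
  - by rewrite y0 y2 /= expr0 eq_sym.
(* A chosen vector for each sign pattern; since [A] depends only on the pattern, the choice gives a
   homomorphism. *)
have [rep repE] : exists rep, forall b : bool * bool,
    [/\ T (rep b) 0 0 = (-1) ^+ b.1, T (rep b) 1 1 = (-1) ^+ b.2
      & T (rep b) 2 2 = (-1) ^+ (b.1 (+) b.2)].
  by apply: (fin_all_exists sg_chi).
exists (fun b => A (rep b)); split; [|split; [|split]].
- move=> b b' /= e.
  have eT : T (rep b) = T (rep b') by rewrite /T e.
  have [e0 e1 _] := repE b; have [e0' e1' _] := repE b'.
  move: e0 e1; rewrite eT e0' e1' => /signr_inj e0 /signr_inj e1.
  by case: b b' e0 e1 {e e0' e1' eT} => [? ?] [? ?] /= -> ->.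
- move=> b b'; rewrite -AD; apply: chi_inj => i; rewrite chiD /=.
  have [e0 e1 e2] := repE b; have [e0' e1' e2'] := repE b'.
  have [/= e0'' e1'' e2''] := repE (b.1 (+) b'.1, b.2 (+) b'.2).
  elim/ord3P: i; rewrite ?e0 ?e1 ?e2 ?e0' ?e1' ?e2' ?e0'' ?e1'' ?e2''.
  + by rewrite signr_addb.
  + by rewrite signr_addb.
  + by rewrite -signr_addb addbACA.
- move=> l; have [b [e0 e1 e2]] := chi_sg l; exists b; apply: chi_inj.
  by have [e0' e1' e2'] := repE b; apply: ord3P; rewrite ?e0 ?e1 ?e2.
- by move=> b; exists (rep b).
Qed.

(** * The adapted basis of $\mathbb{Z}^p$ and the conclusion *)

Lemma Klein_phi1 (p : nat) (A : 'rV[int]_p -> 'M[int]_3)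
    (phi : bool * bool -> 'M[int]_3) :
  is_action A ->
  (forall x y, phi (x.1 (+) y.1, x.2 (+) y.2) = phi x *m phi y) ->
  (forall x, exists l, A l = phi x) -> phi (false, false) = 1%:M.
Proof.
move=> [uA _] phiD phiA; have [l e] := phiA (false, false).
have := phiD (false, false) (false, false); rewrite /= -e => e'.
by rewrite -[LHS](mulKmx (uA l)) -e' mulVmx.
Qed.

(** The exponent matrix has only two columns, so after row reduction all its rows from index 2 on
    vanish; the corresponding basis vectors act trivially. *)
Lemma adapted_basis (p : nat) (A : 'rV[int]_p -> 'M[int]_3) :
  is_action A -> image_iso_Klein A ->
  exists2 W : 'M[int]_p, W \in unitmx
    & forall l : 'rV[int]_p, (forall i : 'I_p, (i < 2)%N -> l 0 i = 0) ->
        A (l *m W) = 1%:M.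
Proof.
move=> actA [phi [_ [phiD [Aphi phiA]]]]; have [uA AD] := actA.
have phi0 := Klein_phi1 p A phi actA phiD phiA.
have phi_sq x : phi x *m phi x = 1%:M.
  by rewrite -phiD !addbb.
have [x Ax] := fin_all_exists (fun i : 'I_p => Aphi 'e_i).
(* The bits of the generators are lifted to the integers 0 and 1, so that the reduction is
   unimodular over $\mathbb{Z}$; [bits] reduces modulo 2 again. *)
pose M : 'M[int]_(p, 2) := \matrix_(i, j) Posz (if j == 0 then (x i).1 else (x i).2).
pose bits (v : 'rV[int]_2) := (odd (absz (v 0 0)), odd (absz (v 0 1))).
have AM l : A l = phi (bits (l *m M)).
  have bitsx i : bits ('e_i *m M) = x i.
    by rewrite -rowE /bits !mxE /= !oddb; case: (x i).
  elim/int_row_ind: l => [|u v eu ev|i|i].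
  - by rewrite action0 // mul0mx /bits !mxE.
  - rewrite AD eu ev -phiD mulmxDl; congr phi; rewrite /bits /= !mxE.
    congr pair; lia.
  - by rewrite bitsx.
  - rewrite mulNmx actionN // Ax.
    have -> v : bits (- v) = bits v by rewrite /bits !mxE !abszN.
    rewrite bitsx.
    by rewrite -[LHS]mulmx1 -(phi_sq (x i)) mulKmx // -Ax.
have [W uW WM] := int_hermite _ _ M.
exists W => // l l0; rewrite AM -mulmxA.
have -> : l *m (W *m M) = 0.
  apply/matrixP => i j; rewrite (ord1 i) !mxE big1 // => k _.
  have [k2|k2] := ltnP k 2; first by rewrite l0 ?mul0r.
  by rewrite WM ?mulr0 // (leq_trans _ k2).
by rewrite /bits !mxE.
Qed.

Theorem theorem2 (p : nat) (hp : (2 <= p)%N) (A : 'rV[int]_p -> 'M[int]_3) :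
  spectrally_unitary A -> trivial_Fix A ->
  exists (W : 'M[int]_p) (h : 'M[int]_3) (a b c d : int),
    [/\ W \in unitmx /\ h \in unitmx,
        a * d + 2 * (b + c) = 0 /\ image_iso_Klein A,
        (forall i : 'I_p, val i = 0%N -> h *m A (row i W) *m invmx h = M1 a b),
        (forall i : 'I_p, val i = 1%N -> h *m A (row i W) *m invmx h = M2 c d)
      &
        (forall l : 'rV[int]_p, (forall i : 'I_p, (val i < 2)%N -> l 0 i = 0) ->
            h *m A (l *m W) *m invmx h = 1%:M)].
Proof.
move=> suA fixA; have KA := image_Klein p A suA fixA.
have [actA specA] := suA; have [uA AD] := actA.
have [W uW WA] := adapted_basis p A actA KA.
pose i0 := Ordinal (ltnW hp); pose i1 := Ordinal hp.
have sqA l : A l *m A l = 1%:M.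
  have [phi [_ [phiD [Aphi phiA]]]] := KA; have [x ->] := Aphi l.
  by rewrite -phiD !addbb (Klein_phi1 p A phi actA phiD phiA).
have [|||||||h [a [b [c [d [uh abcd hX hY]]]]]] :=
    involutions_normal_form (A (row i0 W)) (A (row i1 W)).
- exact: sqA.
- exact: sqA.
- by rewrite -!AD addrC.
(* The rows of [W] other than the first two act trivially, so a vector fixed by both involutions is
   fixed by the whole action. *)
- move=> k Xk Yk; apply: fixA; apply: (action_fixed _ _ _ _ actA uW) => i.
  have [e|ne0] := eqVneq i i0; first by rewrite e.
  have [e|ne1] := eqVneq i i1; first by rewrite e.
  rewrite rowE WA ?mul1mx // => j j2; rewrite mxE eqxx /=.
  case: eqP => // ji; move: j2 ne0 ne1; rewrite ji -!val_eqE /=.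
  by case: (val i) => [|[]].
- exact/char_poly_root1/specA.
- exact/char_poly_root1/specA.
(* The product of the two involutions is the value of [A] at the sum of the first two basis vectors,
   where 1 is again an eigenvalue. *)
- by rewrite -AD; apply/char_poly_root1/specA.
exists W, h, a, b, c, d; split=> // [i i_0|i i_1|l l0].
- by rewrite (_ : i = i0) //; apply: val_inj.
- by rewrite (_ : i = i1) //; apply: val_inj.
- by rewrite WA // mulmx1 mulmxV.
Qed.
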